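(* Let $M$ be a connected, complete, non-compact Riemannian manifold which is simply connected. Let $G=(V,E)$ be a graph such that $V\subset M$. Assume that to each $x\in V$ we can associate an open connected set $O(x)\subset M$ containing $x$ such that (i) $\bigcup_{x\in V}O(x)=M$; (ii) for $x\neq y$ in $V$, $O(x)\cap O(y)\neq\emptyset$ if and only if $\{x,y\}\in E$. Then for all $x,y\in V$, any minimal cutset separating $x$ from $y$ is connected in $G$. If we further assume that $G$ is one-ended and locally finite (which holds, for instance, if $M$ itself is one-ended, the sets $O(x)$ are all bounded and any bounded set $B\subset M$ intersects at most finitely many of the sets $O(x)$), then for every $x\in V$ any minimal cutset separating $x$ from infinity is connected in $G$.
   Context: Graphs are simple and undirected. For $x\in V$ and $y\in V\cup\{\infty\}$, a set $\Gamma\subset V$ is a cutset separating $x$ from $y$ if any path from $x$ to $y$ in $G$ intersects $\Gamma$ (endpoints included); a path from $x$ to $\infty$ is an infinite simple path started at $x$. A cutset $\Gamma$ is minimal if for every $w\in\Gamma$ the set $\Gamma\setminus\{w\}$ is no longer a cutset. A set $\Gamma\subset V$ is connected in $G$ if the subgraph of $G$ induced by $\Gamma$ is connected. $G$ is one-ended if for any finite set $\Gamma\subset V$ the induced subgraph on $V\setminus\Gamma$ has a unique infinite connected component; $G$ is locally finite if every vertex has finite degree. $M$ is one-ended if $M\setminus B$ has exactly one unbounded connected component for any bounded $B\subset M$. *)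

(* Defs.v *)
From HB Require Import structures.
From mathcomp Require Import all_boot all_order all_algebra.
From mathcomp Require Import all_classical all_reals all_analysis.

Set Implicit Arguments.
Unset Strict Implicit.
Unset Printing Implicit Defensive.

Import Order.TTheory GRing.Theory Num.Theory.
Import numFieldNormedType.Exports.

Local Open Scope classical_set_scope.
Local Open Scope ring_scope.

(* The edge relation lives on the ambient type [T]; [edge_vert] (together with
   symmetry) confines it to the vertex set. *)
Record graph (T : Type) := Graph {
  vert : set T;
  edge : T -> T -> Prop;
  edge_vert : forall x y, edge x y -> vert x;
  edge_sym : forall x y, edge x y -> edge y x;
  edge_irrefl : forall x, ~ edge x x }.

Section Graphs.
Variables (T : Type) (G : graph T).
Implicit Types (x : T) (p : nat -> T) (S Gamma : set T).

(* The vertices of the path are [p 0, ..., p k]; repetitions are allowed. *)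
Definition is_path p (k : nat) x y : Prop :=
  [/\ p 0%N = x, p k = y, (forall i, (i <= k)%N -> vert G (p i)) &
      forall i, (i < k)%N -> edge G (p i) (p i.+1)].

Definition is_ray p x : Prop :=
  [/\ p 0%N = x, injective p & forall i, edge G (p i) (p i.+1)].

(* [None] plays the role of the point at infinity. *)
Definition cutset x (y : option T) Gamma : Prop :=
  Gamma `<=` vert G /\
  match y with
  | Some z => forall p k, is_path p k x z -> exists2 i, (i <= k)%N & Gamma (p i)
  | None => forall p, is_ray p x -> exists i, Gamma (p i)
  end.

Definition minimal_cutset x (y : option T) Gamma : Prop :=
  cutset x y Gamma /\ forall w, Gamma w -> ~ cutset x y (Gamma `\ w).

Definition joined_in S x y : Prop :=
  exists p k, is_path p k x y /\ forall i, (i <= k)%N -> S (p i).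

Definition graph_connected S : Prop :=
  forall x y, S x -> S y -> joined_in S x y.

Definition graph_component S C : Prop :=
  exists2 x, S x & C = [set y | joined_in S x y].

Definition one_ended_graph : Prop :=
  forall Gamma, finite_set Gamma -> Gamma `<=` vert G ->
    exists! C, graph_component (vert G `\` Gamma) C /\ infinite_set C.

Definition locally_finite : Prop :=
  forall x, vert G x -> finite_set [set y | edge G x y].

End Graphs.

Section Smooth.
Variables (R : realType) (V W : normedModType R).

(* Meant for open [U]: [f] is of class C^k on [U]. *)
Fixpoint class_C (k : nat) (U : set V) (f : V -> W) : Prop :=
  match k with
  | 0 => forall x, U x -> {for x, continuous f}
  | k'.+1 => (forall x, U x -> differentiable f x) /\
             forall v, class_C k' U ('D_v f)
  end.

Definition smooth_on (U : set V) (f : V -> W) : Prop :=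
  forall k, class_C k U f.

End Smooth.

(* Smooth Hausdorff second countable manifold without boundary, of dimension
   [n], given by an atlas, together with a Riemannian metric given by its
   coordinate expression [tensor i] in every chart.  Charts and
   their inverses are total, with irrelevant values outside [dom i] and
   [img i]. *)
Record riemannian_manifold (R : realType) (n : nat) (M : topologicalType) :=
  RiemannianManifold {
  rm_hausdorff : hausdorff_space M;
  rm_second_countable : @second_countable M;
  idx : Type;
  dom : idx -> set M;
  img : idx -> set 'rV[R]_n;
  chart : idx -> M -> 'rV[R]_n;
  param : idx -> 'rV[R]_n -> M;
  dom_open : forall i, open (dom i);
  img_open : forall i, open (img i);
  chart_img : forall i p, dom i p -> img i (chart i p);
  param_dom : forall i x, img i x -> dom i (param i x);
  chartK : forall i p, dom i p -> param i (chart i p) = p;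
  paramK : forall i x, img i x -> chart i (param i x) = x;
  chart_continuous : forall i p, dom i p -> {for p, continuous (chart i)};
  param_continuous : forall i x, img i x -> {for x, continuous (param i)};
  chart_at : M -> idx;
  dom_chart_at : forall p, dom (chart_at p) p;
  transition_smooth : forall i j,
    smooth_on [set x | img i x /\ dom j (param i x)] (chart j \o param i);
  tensor : idx -> 'rV[R]_n -> 'M[R]_n;
  tensor_smooth : forall i, smooth_on (img i) (tensor i);
  tensor_sym : forall i x, img i x -> (tensor i x)^T = tensor i x;
  tensor_pos : forall i x (v : 'rV[R]_n), img i x -> v != 0 ->
    0 < (v *m tensor i x *m v^T) 0 0;
  tensor_compat : forall i j x (v w : 'rV[R]_n),
    img i x -> dom j (param i x) ->
    let tau := chart j \o param i in
    (v *m tensor i x *m w^T) 0 0 =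
    ('d tau x v *m tensor j (tau x) *m ('d tau x w)^T) 0 0 }.

Arguments dom {R n M} _ _.
Arguments img {R n M} _ _.
Arguments chart {R n M} _ _ _.
Arguments param {R n M} _ _ _.
Arguments chart_at {R n M} _ _.
Arguments tensor {R n M} _ _ _.

Section RiemannianDistance.
Variables (R : realType) (n : nat) (M : topologicalType).
Variable g : riemannian_manifold R n M.
Implicit Types (c : R -> M) (p q : M) (B : set M).

(* C^1 on a neighbourhood of [0, 1]. *)
Definition C1_curve c : Prop :=
  exists2 e : R, 0 < e & forall t : R, - e < t < 1 + e ->
    {for t, continuous c} /\
    forall i, dom g i (c t) ->
      derivable (chart g i \o c) t 1 /\
      {for t, continuous (derive1 (chart g i \o c))}.

(* By [tensor_compat] any chart around [c t] gives the same value. *)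
Definition speed c (t : R) : R :=
  let i := chart_at g (c t) in
  let v := derive1 (chart g i \o c) t in
  Num.sqrt ((v *m tensor g i (chart g i (c t)) *m v^T) 0 0).

Definition curve_length c : \bar R :=
  (\int[lebesgue_measure]_(t in `[0%R, 1%R]) (speed c t)%:E)%E.

(* [curve_joins p q l]: there is a piecewise C^1 curve, i.e. a finite
   concatenation of C^1 curves, of total length [l] from [p] to [q]. *)
Inductive curve_joins : M -> M -> \bar R -> Prop :=
| curve_nil p : curve_joins p p 0%E
| curve_cons c q l : C1_curve c -> curve_joins (c 1) q l ->
    curve_joins (c 0) q (curve_length c + l)%E.

Definition riem_dist p q : \bar R := ereal_inf [set l | curve_joins p q l].

Definition riem_bounded B : Prop :=
  exists r : R, forall p q, B p -> B q -> (riem_dist p q <= r%:E)%E.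

Definition riem_complete : Prop :=
  forall u : nat -> M,
    (forall e : R, 0 < e -> exists N, forall m k, (N <= m)%N -> (N <= k)%N ->
       (riem_dist (u m) (u k) < e%:E)%E) ->
    exists p, forall e : R, 0 < e -> exists N, forall m, (N <= m)%N ->
       (riem_dist (u m) p < e%:E)%E.

Definition one_ended_manifold : Prop :=
  forall B, riem_bounded B ->
    exists! C, (exists2 p, (~` B) p & C = connected_component (~` B) p) /\
               ~ riem_bounded C.

End RiemannianDistance.

Section SimplyConnected.
Variables (R : realType) (M : topologicalType).

Definition path_joined (p q : M) : Prop :=
  exists c : R -> M, [/\ {within `[0, 1], continuous c}, c 0 = p & c 1 = q].

Definition null_homotopic (c : R -> M) : Prop :=
  exists H : R * R -> M,
    [/\ {within `[0, 1] `*` `[0, 1], continuous H},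
        (forall t : R, t \in `[0, 1] -> H (0, t) = c t),
        (forall t : R, t \in `[0, 1] -> H (1, t) = c 0) &
        (forall s : R, s \in `[0, 1] -> H (s, 0) = c 0 /\ H (s, 1) = c 0)].

Definition simply_connected : Prop :=
  (forall p q, path_joined p q) /\
  forall c : R -> M, {within `[0, 1], continuous c} -> c 0 = c 1 ->
    null_homotopic c.

End SimplyConnected.

(* Main.v *)
Require Import Defs.
From HB Require Import structures.
From mathcomp Require Import all_boot all_order all_algebra.
From mathcomp Require Import all_classical all_reals all_analysis.
From mathcomp Require Import lra.

(** Why the theorem is true.

    A disconnected cutset [Gamma] splits as a union of two nonempty sets [A] and
    [B] with no edge between them.  If [Gamma] is minimal, neither [A] nor [B]
    cuts: dropping one vertex of [A] opens a path that still avoids [B], and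
    symmetrically.  So the first two claims follow from a discrete Janiszewski
    theorem ([janiszewski]): if [x] and [y] are joined off [A] and joined off
    [B], and no edge links [A] to [B], then they are joined off the union.  To
    see this, let [C] be the set of vertices joined to [x] off the union, and
    count modulo 2 the edges of a walk that link [C] to [A].  A triangle has 0
    or 2 such edges, since its vertices cannot meet both [A] and [B]; so the
    count is a Z/2-cocycle on the clique complex of [G].  If that cocycle is a
    coboundary, its sum along a walk depends on the endpoints only.  A walk off
    [A] has sum 0; a walk off [B] has sum 0 or 1 according to whether its end is
    in [C].  Hence the end is in [C].

    Simple connectedness of [M] enters only to show that such cocycles are
    coboundaries ([cover_cocycles_trivial]).  A cocycle glues the pieces
    [O u * {0, 1}] into a double cover of [M].  A double cover of a square is
    trivial ([square_section]: the square is cut into small rectangles, and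
    sections are glued along connected overlaps), so null-homotopic loops lift to
    loops ([monodromy]) and the cover of [M] has a global section
    ([flat_global_section]).  Read in the trivialisation over [O u], the section
    is constant because [O u] is connected, and these constants are the potential.
    The Riemannian structure only contributes local path-connectedness here.

    For cutsets at infinity, the component [C] of [x] is finite by Konig's lemma
    ([konig]), hence so is [Gamma], all of whose vertices are adjacent to [C].
    The paths provided by minimality are now rays whose tails leave [Gamma] for
    good, so both end up in the unique infinite component off [Gamma]; joining
    the tails there reduces the claim to [janiszewski].

    Finally let [M] be one-ended with bounded, locally finite [O x].  For a finite
    [Gamma], removing the bounded set [B], union of the [O w] for [w] in [Gamma],
    leaves one unbounded component; the vertices [v] whose [O v] meets it are
    infinitely many and pairwise joined off [Gamma].  Any other infinite component
    off [Gamma] contains a ray; the tail of this ray avoids the finitely many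
    neighbours of [Gamma], so its sets [O] fill a connected unbounded region off
    [B], which must lie in the same component of the complement of [B]
    ([cover_one_ended]). *)

Set Implicit Arguments.
Unset Strict Implicit.
Unset Printing Implicit Defensive.
Import Order.TTheory GRing.Theory Num.Theory.
Import numFieldNormedType.Exports.

Local Open Scope classical_set_scope.
Local Open Scope ring_scope.

(** * Walks and components *)

Section Walks.
Variables (T : Type) (G : graph T).
Implicit Types (S A B : set T) (x y z : T).

Lemma edge_vertr x y : edge G x y -> vert G y.
Proof. by move=> xy; exact: edge_vert (edge_sym xy). Qed.

Lemma joined_in_refl S x : vert G x -> S x -> joined_in G S x x.
Proof. by move=> Vx Sx; exists (fun=> x), 0%N; split. Qed.

Lemma joined_in_step S x y z :
  joined_in G S x y -> S z -> edge G y z -> joined_in G S x z.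
Proof.
move=> [p [k [[p0 pk pV pE] pS]]] Sz yz.
exists (fun i => if (i <= k)%N then p i else z), k.+1; split; first split.
- by rewrite leq0n.
- by rewrite ltnn.
- by move=> i _ /=; case: ifP => [ik|_]; [exact: pV|exact: edge_vertr yz].
- move=> i; rewrite ltnS => ik; rewrite ik; case: ltnP => [/pE //|ki].
  by have -> : i = k; [apply/eqP; rewrite eqn_leq ik ki|rewrite pk].
- by move=> i _; case: ifP => [/pS|].
Qed.

(** Induction along the last edge, which hides the explicit parametrisation of
    walks in all later arguments. *)
Lemma joined_in_ind S x (P : T -> Prop) :
  (vert G x -> S x -> P x) ->
  (forall u v, P u -> S u -> S v -> edge G u v -> P v) ->
  forall y, joined_in G S x y -> P y.
Proof.
move=> Px Pstep y [p [k [[p0 <- pV pE] pS]]].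
suff H i : (i <= k)%N -> P (p i) by exact: H.
elim: i => [_|i IH ik].
  by rewrite p0; apply: Px; rewrite -p0; [exact: pV|exact: pS].
by apply: (Pstep (p i)); [exact/IH/ltnW|exact/pS/ltnW|exact: pS|exact: pE].
Qed.

Lemma joined_in_vertl S x y : joined_in G S x y -> vert G x /\ S x.
Proof. by case=> p [k [[<- _ pV _] pS]]; split; [exact: pV|exact: pS]. Qed.

Lemma joined_in_vertr S x y : joined_in G S x y -> vert G y /\ S y.
Proof. by case=> p [k [[_ <- pV _] pS]]; split; [exact: pV|exact: pS]. Qed.

Lemma joined_in_trans S x y z :
  joined_in G S x y -> joined_in G S y z -> joined_in G S x z.
Proof.
move=> xy; move: z; apply: joined_in_ind => // u v xu _ Sv uv.
exact: joined_in_step uv.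
Qed.

Lemma joined_in_sym S x y : joined_in G S x y -> joined_in G S y x.
Proof.
move: y; apply: joined_in_ind => [|u v ux Su Sv uv].
  exact: joined_in_refl.
apply: joined_in_trans ux; apply: joined_in_step Su (edge_sym uv).
by apply: joined_in_refl => //; apply: edge_vertr uv.
Qed.

Lemma sub_joined_in S S' x y :
  S `<=` S' -> joined_in G S x y -> joined_in G S' x y.
Proof. by move=> sub [p [k [pp pS]]]; exists p, k; split=> // i /pS /sub. Qed.

Lemma component_eq S x y : joined_in G S x y ->
  [set z | joined_in G S x z] = [set z | joined_in G S y z].
Proof.
move=> xy; apply/seteqP; split=> z /= => [xz|]; last exact: joined_in_trans.
by apply: joined_in_trans xz; apply: joined_in_sym.
Qed.

End Walks.

(** * A discrete Janiszewski theorem *)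

Section Janiszewski.
Variables (T : Type) (G : graph T).
Implicit Types (A B : set T) (u v w x y z : T).

Definition close x y := x = y \/ edge G x y.

(** Z/2-valued 1-cocycles on the clique complex of [G].  Degenerate triples are
    included: [u = v = w] makes [phi] vanish on the diagonal and [u = w] makes it
    symmetric on edges. *)
Definition cocycle (phi : T -> T -> bool) := forall u v w,
  close u v -> close v w -> close u w -> phi u w = phi u v (+) phi v w.

(** Vanishing of the first Z/2-cohomology of the clique complex of [G]. *)
Definition cocycles_trivial := forall phi, cocycle phi ->
  exists f : T -> bool, forall u v, edge G u v -> phi u v = f u (+) f v.

(** The cocycle [phi] marks the edges between the component [C] of [x] and [A].
    Off [B] it is the coboundary of the indicator of [C], because an edge leaving
    [C] ends in [A] or [B]; off [A] it vanishes.  A triangle avoids [A] or avoids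
    [B], as no edge joins the two, so [phi] is a cocycle on all of [G].  With a
    potential [f], the walk off [A] gives [f x = f y], and the walk off [B] then
    transfers [x] in [C] to [y] in [C]. *)
Lemma janiszewski A B x y : cocycles_trivial ->
  (forall a b, A a -> B b -> a <> b /\ ~ edge G a b) ->
  joined_in G (vert G `\` A) x y -> joined_in G (vert G `\` B) x y ->
  joined_in G (vert G `\` (A `|` B)) x y.
Proof.
move=> triv AB xyA xyB.
set S := vert G `\` (A `|` B).
have [Vx [_ nAx]] := joined_in_vertl xyA.
have [_ [_ nBx]] := joined_in_vertl xyB.
have Sx : S x by split => // -[].
pose C : set T := [set z | joined_in G S x z].
have Cx : C x by exact: joined_in_refl.
have CS z : C z -> S z by move=> xz; have [] := joined_in_vertr xz.
have CA z : C z -> ~ A z by move=> /CS [_ nAB] Az; apply: nAB; left.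
have C_closed u v : C u -> edge G u v -> C v \/ A v \/ B v.
  move=> Cu uv; have [Sv|nSv] := pselect (S v).
    by left; apply: joined_in_step Cu Sv uv.
  have [Av|nAv] := pselect (A v); first by right; left.
  right; right; apply: contrapT => nBv; apply: nSv; split=> [|[]//].
  exact: edge_vertr uv.
pose phi u v := `[< C u /\ A v >] (+) `[< C v /\ A u >].
pose chi u := `[< C u >].
have phiB u v : ~ B u -> ~ B v -> edge G u v -> phi u v = chi u (+) chi v.
  move=> nBu nBv uv; rewrite /phi /chi.
  have := C_closed u v ^~ uv; have := C_closed v u ^~ (edge_sym uv).
  have := CA u; have := CA v.
  case: (asboolP (C u)) => Cu; case: (asboolP (C v)) => Cv;
  case: (asboolP (C u /\ A v)) => CAu;
  case: (asboolP (C v /\ A u)) => CAv //=; by tauto.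
have phiA u v : ~ A u -> ~ A v -> phi u v = false.
  by move=> nAu nAv; rewrite /phi !asbool_and (asboolF nAu) (asboolF nAv) !andbF.
have phiS u v : phi u v = phi v u by rewrite /phi addbC.
have phi0 u : phi u u = false by rewrite /phi addbb.
have phiC : cocycle phi.
  move=> u v w; case=> [<-|uv]; first by rewrite phi0.
  case=> [<-|vw]; first by rewrite phi0 addbF.
  case=> [<-|uw]; first by rewrite phi0 (phiS v) addbb.
  have [[nAu [nAv nAw]]|hasA] := pselect (~ A u /\ ~ A v /\ ~ A w).
    by rewrite !phiA.
  have nB z : close u z -> close v z -> close w z -> ~ B z.
    move=> uz vz wz Bz; apply: hasA.
    by split; [|split] => Az; have [neq nE] := AB _ _ Az Bz;
      [case: uz|case: vz|case: wz].
  have nBu : ~ B u by apply: nB; [left|right; exact: edge_sym uv|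
    right; exact: edge_sym uw].
  have nBv : ~ B v by apply: nB; [right|left|right; exact: edge_sym vw].
  have nBw : ~ B w by apply: nB; [right|right|left].
  rewrite !phiB //.
  by case: (chi u); case: (chi v); case: (chi w).
have [f fP] := triv _ phiC.
have fA : f x = f y.
  move: xyA; apply: (joined_in_ind (P := fun z => f x = f z)) => //.
  move=> u v -> [_ nAu] [_ nAv] uv; move: (fP _ _ uv); rewrite phiA //.
  by case: (f u); case: (f v).
have fB : f x (+) chi x = f y (+) chi y.
  move: xyB; apply: (joined_in_ind (P := fun z => f x (+) chi x = f z (+) chi z)) => //.
  move=> u v -> [_ nBu] [_ nBv] uv; move: (fP _ _ uv); rewrite phiB //.
  by case: (f u); case: (f v); case: (chi u); case: (chi v).
have : chi y.
  by move: fB; rewrite fA => /addbI <-; apply/asboolP.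
by move/asboolP.
Qed.

End Janiszewski.

(** * Rays and infinite components *)

Section Rays.
Variables (T : Type) (G : graph T).
Implicit Types (S : set T) (x y z : T) (p : nat -> T).

Lemma ray_vert p x i : is_ray G p x -> vert G (p i).
Proof. by case=> _ _ pE; exact: edge_vert (pE i). Qed.

Lemma ray_joined_in S p x i j : is_ray G p x -> (i <= j)%N ->
  (forall k, (i <= k <= j)%N -> S (p k)) -> joined_in G S (p i) (p j).
Proof.
move=> ray; elim: j => [|j IH].
  rewrite leqn0 => /eqP -> H; apply: joined_in_refl; last exact: H.
  exact: ray_vert ray.
rewrite leq_eqVlt => /orP[/eqP->|ij] H.
  by apply: joined_in_refl; [exact: ray_vert ray|apply: H; rewrite leqnn].
have [_ _ E] := ray.
apply: (joined_in_step _ _ (E j)); last by apply: H; rewrite leqnn ltnW.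
apply: IH; first exact: ij.
by move=> k /andP[ik kj]; apply: H; rewrite ik /= ltnW.
Qed.

(** After [x], every walk from [x] passes through a neighbour and need not come
    back to [x]; so finitely many components of [S `\ x] cover the component of
    [x] up to [x] itself, and one of them is infinite. *)
Lemma infinite_component_step S x : locally_finite G ->
  infinite_set [set y | joined_in G S x y] ->
  exists u, edge G x u /\ infinite_set [set y | joined_in G (S `\ x) u y].
Proof.
move=> lf inf; apply: contrapT => nex; apply: inf.
have [[y xy]|none] := pselect (exists y, joined_in G S x y); last first.
  rewrite (_ : mkset _ = set0); first exact: finite_set0.
  by apply/seteqP; split=> // y /= xy; apply: none; exists y.
have [Vx _] := joined_in_vertl xy.
apply: (@sub_finite_set _ _ (x |` \bigcup_(u in [set u | edge G x u])
   [set y | joined_in G (S `\ x) u y])); last first.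
  rewrite finite_setU; split; first exact: finite_set1.
  apply: bigcup_finite => [|u xu]; first exact: lf.
  by apply: contrapT => uinf; apply: nex; exists u.
apply: joined_in_ind => [_ _|u v Pu Su Sv uv]; first by left.
have [->|/eqP vx] := eqVneq (v : {classic T}) x; first by left.
right; case: Pu => [ux|[w xw wu]].
  exists v; first by rewrite -ux.
  by apply: joined_in_refl; [exact: edge_vertr uv|split].
by exists w => //; apply: joined_in_step wu _ uv; split.
Qed.

(** Konig's lemma.  The state carried along is the set still allowed and the
    current vertex; each visited vertex is removed, which makes the ray simple. *)
Lemma konig S x : locally_finite G ->
  infinite_set [set y | joined_in G S x y] ->
  exists2 p, is_ray G p x & forall i, S (p i).
Proof.
move=> lf inf.
pose inv (s : set T * T) := infinite_set [set y | joined_in G s.1 s.2 y].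
have /choice [next nextP] : forall s : set T * T, exists u, inv s ->
    edge G s.2 u /\ inv (s.1 `\ s.2, u).
  move=> s; have [/(infinite_component_step lf) [u uP]|ns] := pselect (inv s).
    by exists u.
  by exists s.2.
pose st i := iter i (fun s => (s.1 `\ s.2, next s)) (S, x).
have stP i : inv (st i).
  by elim: i => [|i IH] //=; have [] := nextP _ IH.
have stin i : (st i).1 (st i).2.
  apply: contrapT => nin; apply: (stP i).
  rewrite (_ : mkset _ = set0); first exact: finite_set0.
  by apply/seteqP; split=> // y xy; have [] := joined_in_vertl xy.
have stdec i d : (st (i + d)%N).1 `<=` (st i).1.
  elim: d => [|d IH]; first by rewrite addn0.
  by rewrite addnS /= => z [/IH].
have stlt i j : (i < j)%N -> (st i).2 <> (st j).2.
  move=> ij eq; have := stdec i.+1 (j - i.+1)%N (st j).2.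
  by rewrite subnKC // => /(_ (stin j)) [_]; apply; exact: esym.
exists (fun i => (st i).2) => [|i].
  split=> // [i j ij|i]; last by have [] := nextP _ (stP i).
  by case: (ltngtP i j) => // /stlt; rewrite ij.
by have := stin i; rewrite -[i]add0n => /stdec.
Qed.

End Rays.

Lemma avoid_finite (T : Type) (p : nat -> T) (F : set T) :
  injective p -> finite_set F -> exists N, forall i, (N <= i)%N -> ~ F (p i).
Proof.
move=> pinj finF.
have : finite_set (p @^-1` F) by apply: finite_preimage finF => i j _ _; exact: pinj.
move=> /finite_seqP [s sP]; exists (\max_(j <- s) j).+1 => i Ni Fi.
have si : i \in s by have : (p @^-1` F) i by []; rewrite sP.
by have := @leq_bigmax_seq _ s xpredT id i si isT; rewrite leqNgt Ni.
Qed.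

(** * Minimal cutsets *)

Section Cutsets.
Variables (T : Type) (G : graph T).
Implicit Types (S A B Gamma : set T) (x y z : T) (p : nat -> T).

(** [A] is a component of [Gamma] and [B] the rest. *)
Lemma disconnected_split Gamma : Gamma `<=` vert G -> ~ graph_connected G Gamma ->
  exists A B, [/\ A !=set0, B !=set0, Gamma = A `|` B &
    forall a b, A a -> B b -> a <> b /\ ~ edge G a b].
Proof.
move=> GV disc.
have [a [b [Ga Gb nab]]] : exists a b, [/\ Gamma a, Gamma b & ~ joined_in G Gamma a b].
  apply: contrapT => none; apply: disc; move=> a b Ga Gb; apply: contrapT => nab.
  by apply: none; exists a, b.
pose A := [set z | joined_in G Gamma a z].
have AG : A `<=` Gamma by move=> z az; have [] := joined_in_vertr az.
exists A, (Gamma `\` A); split.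
- by exists a; apply: joined_in_refl => //; exact: GV.
- by exists b.
- by rewrite setDUK.
- move=> u v Au [Gv nAv]; split=> [uv|uv]; first by apply: nAv; rewrite -uv.
  by apply: nAv; exact: joined_in_step Au Gv uv.
Qed.

Lemma cutset_not_joined x y Gamma :
  cutset G x (Some y) Gamma -> ~ joined_in G (vert G `\` Gamma) x y.
Proof. by move=> [_ cut] [p [k [xy pS]]]; have [i /pS []] := cut p k xy. Qed.

Lemma not_cutset_joined x y S : S `<=` vert G -> ~ cutset G x (Some y) S ->
  joined_in G (vert G `\` S) x y.
Proof.
move=> SV ncut; apply: contrapT => nj; apply: ncut; split=> // p k xy.
apply: contrapT => nohit; apply: nj; exists p, k; split=> // i ik.
have [_ _ pV _] := xy.
by split; [exact: pV|move=> Si; apply: nohit; exists i].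
Qed.

Lemma not_cutset_ray x S : S `<=` vert G -> ~ cutset G x None S ->
  exists2 p, is_ray G p x & forall i, ~ S (p i).
Proof.
move=> SV ncut; apply: contrapT => none; apply: ncut; split=> // p ray.
by apply: contrapT => nohit; apply: none; exists p => // i Si; apply: nohit; exists i.
Qed.

(** Restoring a vertex [b] of [B] opens a path whose only vertices in [Gamma] are
    equal to [b]; it avoids [A].  Likewise with the roles exchanged, and the two
    paths contradict [janiszewski]. *)
Lemma minimal_cutset_connected x y Gamma : cocycles_trivial G ->
  minimal_cutset G x (Some y) Gamma -> graph_connected G Gamma.
Proof.
move=> triv [cut min]; apply: contrapT.
have GV : Gamma `<=` vert G by case: cut.
move=> /(disconnected_split GV) [A [B [[a Aa] [b Bb] GAB AB]]].
have GA : A `<=` Gamma by rewrite GAB; exact: subsetUl.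
have GB : B `<=` Gamma by rewrite GAB; exact: subsetUr.
apply: (cutset_not_joined cut); rewrite GAB; apply: janiszewski => //.
- apply: sub_joined_in (not_cutset_joined _ (min _ (GB _ Bb))); last first.
    by apply: subset_trans GV => z [].
  move=> z [Vz nz]; split=> // Az; apply: nz; split; first exact: GA.
  by move=> zb; have [] := AB z b Az Bb.
- apply: sub_joined_in (not_cutset_joined _ (min _ (GA _ Aa))); last first.
    by apply: subset_trans GV => z [].
  move=> z [Vz nz]; split=> // Bz; apply: nz; split; first exact: GB.
  by move=> za; have [/(_ (esym za))] := AB a z Aa Bz.
Qed.

Lemma tail_infinite p N A : injective p -> (forall i, (N <= i)%N -> A (p i)) ->
  infinite_set A.
Proof.
move=> pinj pA finA; apply: infinite_nat.
have : finite_set ((fun i => p (N + i)%N) @^-1` A).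
  by apply: finite_preimage finA => i j _ _ /pinj; exact: addnI.
by apply: sub_finite_set => i _; apply: pA; exact: leq_addr.
Qed.

(** Otherwise Konig's lemma gives a ray from [x] that misses [Gamma]. *)
Lemma finite_cutset_component x Gamma : locally_finite G ->
  cutset G x None Gamma -> finite_set [set z | joined_in G (vert G `\` Gamma) x z].
Proof.
move=> lf [_ cut]; apply: contrapT => /(konig lf) [p ray pS].
by have [i Gi] := cut p ray; case: (pS i).
Qed.

(** By minimality some ray meets [Gamma] exactly at [w]; the vertex before [w] on
    it is in the component of [x].  So [Gamma] consists of neighbours of a finite
    set in a locally finite graph. *)
Lemma finite_minimal_cutset x Gamma : locally_finite G -> ~ Gamma x ->
  minimal_cutset G x None Gamma -> finite_set Gamma.
Proof.
move=> lf nGx [cut min]; have GV : Gamma `<=` vert G by case: cut.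
set S := vert G `\` Gamma.
apply: (@sub_finite_set _ _ (\bigcup_(v in [set z | joined_in G S x z])
   [set w | edge G v w])).
  move=> w Gw; have [|p ray pn] := not_cutset_ray _ (min w Gw).
    by apply: subset_trans GV => z [].
  have [i Gi] := cut.2 p ray.
  have pw j : Gamma (p j) -> p j = w.
    by move=> Gj; apply: contrapT => neq; apply: (pn j).
  have [p0 pinj pE] := ray.
  case: i Gi => [|i] Gi; first by rewrite p0 in Gi.
  exists (p i); last by rewrite /= -(pw _ Gi).
  rewrite /= -{1}p0; apply: (ray_joined_in ray) => // k /andP[_ ki].
  split; first exact: ray_vert ray.
  move=> Gk; have /pinj eq : p k = p i.+1 by rewrite (pw _ Gk) (pw _ Gi).
  by move: ki; rewrite eq ltnn.
apply: bigcup_finite; first exact: finite_cutset_component.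
by move=> v xv; have [Vv _] := joined_in_vertr xv; exact: lf.
Qed.

(** A ray is simple, so it meets [Gamma] at most once, at [a]. *)
Lemma ray_tail_off_cutset x p Gamma a : is_ray G p x ->
  (forall i, ~ (Gamma `\ a) (p i)) ->
  exists N, forall i, (N <= i)%N -> (vert G `\` Gamma) (p i).
Proof.
move=> ray pn; have [_ pinj _] := ray.
have pa i : Gamma (p i) -> p i = a.
  by move=> Gi; apply: contrapT => neq; apply: (pn i).
have [[i pi]|none] := pselect (exists i, Gamma (p i)).
  exists i.+1 => j ij; split; first exact: ray_vert ray.
  move=> pj; have /pinj e : p i = p j by rewrite (pa _ pi) (pa _ pj).
  by rewrite e ltnn in ij.
exists 0%N => i _; split; first exact: ray_vert ray.
by move=> Gi; apply: none; exists i.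
Qed.

Lemma one_ended_joined Gamma u v : one_ended_graph G -> finite_set Gamma ->
  Gamma `<=` vert G ->
  infinite_set [set z | joined_in G (vert G `\` Gamma) u z] ->
  infinite_set [set z | joined_in G (vert G `\` Gamma) v z] ->
  joined_in G (vert G `\` Gamma) u v.
Proof.
set S := vert G `\` Gamma => oe fG GV iu iv.
have [C [_ Cuniq]] := oe _ fG GV.
have comp t : infinite_set [set z | joined_in G S t z] ->
    S t /\ C = [set z | joined_in G S t z].
  move=> it.
  have [z tz] : exists z, joined_in G S t z.
    apply: contrapT => none; apply: it; rewrite (_ : mkset _ = set0).
      exact: finite_set0.
    by apply/seteqP; split=> // z tz; apply: none; exists z.
  have [_ St] := joined_in_vertl tz.
  by split=> //; apply: Cuniq; split=> //; exists t.
have [[Vv nGv] Cv] := comp v iv; have [_ Cu] := comp u iu.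
suff : C v by rewrite Cu.
by rewrite Cv; apply: joined_in_refl.
Qed.

(** The two rays given by minimality have tails in the same infinite component
    off [Gamma].  Continuing one ray to the tail of the other yields a common
    endpoint [p N] for [janiszewski], which puts [p N], hence an infinite set, in
    the finite component of [x]. *)
Lemma minimal_cutset_infinity_connected x Gamma : cocycles_trivial G ->
  one_ended_graph G -> locally_finite G ->
  minimal_cutset G x None Gamma -> graph_connected G Gamma.
Proof.
move=> triv oe lf mcut; have [cut min] := mcut.
have GV : Gamma `<=` vert G by case: cut.
apply: contrapT => /(disconnected_split GV) [A [B [[a Aa] [b Bb] GAB AB]]].
have GA : A `<=` Gamma by rewrite GAB; exact: subsetUl.
have GB : B `<=` Gamma by rewrite GAB; exact: subsetUr.
have [|p pray pn] := not_cutset_ray _ (min a (GA _ Aa)).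
  by apply: subset_trans GV => z [].
have [|q qray qn] := not_cutset_ray _ (min b (GB _ Bb)).
  by apply: subset_trans GV => z [].
have pB i : ~ B (p i).
  move=> Bi; apply: (pn i); split; first exact: GB.
  by move=> e; have [/(_ (esym e))] := AB a _ Aa Bi.
have qA i : ~ A (q i).
  move=> Ai; apply: (qn i); split; first exact: GA.
  by move=> e; have [] := AB _ b Ai Bb.
have [p0 pinj _] := pray; have [q0 qinj _] := qray.
have nGx : ~ Gamma x.
  by rewrite GAB => -[Ax|Bx]; [apply: (qA 0%N); rewrite q0|apply: (pB 0%N); rewrite p0].
have fG := finite_minimal_cutset lf nGx mcut.
set S := vert G `\` Gamma.
have tail r : is_ray G r x -> injective r ->
    (exists N, forall i, (N <= i)%N -> S (r i)) ->
    exists N, infinite_set [set z | joined_in G S (r N) z].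
  move=> rray rinj [N rS]; exists N; apply: (@tail_infinite r N) => // i Ni.
  by apply: (ray_joined_in rray) => // k /andP[Nk _]; exact: rS.
have [N ipN] := tail p pray pinj (ray_tail_off_cutset pray pn).
have [N' iqN] := tail q qray qinj (ray_tail_off_cutset qray qn).
have pq : joined_in G S (q N') (p N) by exact: one_ended_joined.
suff xp : joined_in G S x (p N).
  apply: ipN; rewrite -(component_eq xp).
  exact: finite_cutset_component.
rewrite /S GAB; apply: janiszewski => //.
- apply: (@joined_in_trans _ _ _ _ (q N')).
    rewrite -[x in joined_in _ _ x]q0; apply: (ray_joined_in qray) => // k _.
    by split; [exact: ray_vert qray|exact: qA].
  by apply: sub_joined_in pq => z [Vz nGz]; split=> // /GA.
- rewrite -[x in joined_in _ _ x]p0; apply: (ray_joined_in pray) => // k _.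
  by split; [exact: ray_vert pray|exact: pB].
Qed.

End Cutsets.

(** * Sections of a double cover *)

Section Sections.
Variable X : topologicalType.
Implicit Types (psi : X -> X -> bool) (D : set X) (k : X -> bool).

(** A double cover of [D], described by the change [psi x y] of sheet label when
    the label at [x] is carried to a nearby point [y].  Additivity is asked only
    when [y] is close to [x] and [z] is close to both: closeness is measured at
    the first argument, so a relation for all [y], [z] close to [x] would be too
    strong for the covers of interest. *)
Definition flat_on D psi := forall x, D x ->
  \forall y \near x, D y -> \forall z \near y, D z ->
    psi x z = psi x y (+) psi y z.

(** A continuous section of the double cover given by [psi]. *)
Definition section psi D k := forall x, D x ->
  \forall y \near x, D y -> k y = k x (+) psi x y.

Lemma flat_refl D psi x : flat_on D psi -> D x -> psi x x = false.
Proof.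
move=> fl Dx; have := nbhs_singleton (fl x Dx) Dx.
by move=> /nbhs_singleton /(_ Dx); case: (psi x x).
Qed.

Lemma sub_section D D' psi k : D' `<=` D -> section psi D k -> section psi D' k.
Proof.
move=> sub kP x /sub Dx; apply: filterS (kP x Dx) => y yP /sub; exact: yP.
Qed.

Lemma section_shift D psi k b :
  section psi D k -> section psi D (fun x => k x (+) b).
Proof.
by move=> kP x Dx; apply: filterS (kP x Dx) => y yP /yP ->; rewrite addbAC.
Qed.

Lemma locally_constant_connected D k : connected D ->
  (forall x, D x -> \forall y \near x, D y -> k y = k x) ->
  forall x y, D x -> D y -> k x = k y.
Proof.
move=> cD loc x y Dx Dy.
(* S true and the complement of S false both cut out of D the set where
   k takes the value k x *)
pose S (b : bool) := [set t | D t -> (k t == k x) = b]^°.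
have S_open b : open (S b) by exact: open_interior.
suff kD : [set z | D z /\ k z = k x] = D by move: Dy; rewrite -kD => -[].
apply: cD.
- by exists x.
- exists (S true) => //; apply/seteqP; split=> z [Dz].
    by move=> kz; split=> //; apply: filterS (loc z Dz) => t kt /kt ->; apply/eqP.
  by move=> /nbhs_singleton /(_ Dz) /eqP.
- exists (~` S false); first exact: open_closedC.
  apply/seteqP; split=> z [Dz].
    by move=> kz; split=> // /nbhs_singleton /(_ Dz) /eqP.
  move=> nS; split=> //; apply: contrapT => kz; apply: nS.
  by apply: filterS (loc z Dz) => t kt /kt ->; apply/eqP.
Qed.

(** The difference of two sections is locally constant. *)
Lemma section_unique D psi k k' : connected D ->
  section psi D k -> section psi D k' ->
  forall x y, D x -> D y -> k x (+) k' x = k y (+) k' y.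
Proof.
move=> cD kP k'P x y Dx Dy.
apply: (@locally_constant_connected D (fun z => k z (+) k' z)) => // z Dz.
apply: filterS2 (kP z Dz) (k'P z Dz) => t ht h't Dt.
by rewrite ht // h't //; case: (k z); case: (k' z); case: (psi z t).
Qed.

(** Local properties on two closed sets hold on their union: near a point outside
    one of the sets, only the other matters. *)
Lemma near_closedU (D E : set X) (x : X) (P : X -> Prop) :
  closed D -> closed E ->
  (D x -> \forall y \near x, D y -> P y) ->
  (E x -> \forall y \near x, E y -> P y) ->
  \forall y \near x, (D `|` E) y -> P y.
Proof.
have aux F : closed F -> (F x -> \forall y \near x, F y -> P y) ->
    \forall y \near x, F y -> P y.
  move=> cF FP; have [/FP //|nF] := pselect (F x).
  have : nbhs x (~` F) by apply: open_nbhs_nbhs; split => //; apply: closed_openC.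
  by apply: filterS => y nFy /nFy.
move=> cD cE /(aux D cD) DP /(aux E cE) EP.
by apply: filterS2 DP EP => y yD yE [/yD|/yE].
Qed.

(** Two sections differ by a constant on the connected overlap; shifting one of
    them by it makes them agree there. *)
Lemma section_glue D E psi k l : closed D -> closed E ->
  connected (D `&` E) -> section psi D k -> section psi E l ->
  exists m, section psi (D `|` E) m.
Proof.
move=> cD cE cDE kP lP.
have [b klb] : exists b, forall x, D x -> E x -> k x = l x (+) b.
  have [[z [Dz Ez]]|none] := pselect ((D `&` E) !=set0); last first.
    by exists true => x Dx Ex; exfalso; apply: none; exists x.
  exists (l z (+) k z) => x Dx Ex.
  have /(_ x z) := section_unique cDE (sub_section (@subIsetl _ _ _) kP)
    (sub_section (@subIsetr _ _ _) lP).
  move=> /(_ (conj Dx Ex) (conj Dz Ez)).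
  by case: (k x); case: (l x); case: (k z); case: (l z).
have {}lP := section_shift b lP.
exists (fun x => if asbool (D x) then k x else l x (+) b) => x _.
have kD y : D y -> (if asbool (D y) then k y else l y (+) b) = k y.
  by move=> Dy; rewrite asboolT.
have lE y : E y -> (if asbool (D y) then k y else l y (+) b) = l y (+) b.
  by move=> Ey; case: asboolP => // /klb; exact.
apply: near_closedU => // [Dx|Ex].
  by apply: filterS (kP x Dx) => y yP Dy; rewrite !kD // yP.
by apply: filterS (lP x Ex) => y yP Ey; rewrite !lE // yP.
Qed.

End Sections.

Lemma section_const (X : topologicalType) (D : set X) (psi : X -> X -> bool) k :
  connected D -> (forall x y, D x -> D y -> psi x y = false) ->
  section psi D k -> forall x y, D x -> D y -> k x = k y.
Proof.
move=> cD psi0 kP; apply: locally_constant_connected => // x Dx.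
by apply: filterS (kP x Dx) => y yP Dy; rewrite yP // psi0 // addbF.
Qed.

Lemma sectionU (X : topologicalType) (D E : set X) (psi : X -> X -> bool) k :
  closed D -> closed E -> section psi D k -> section psi E k ->
  section psi (D `|` E) k.
Proof. by move=> cD cE kD kE x _; apply: near_closedU => // Dx; auto. Qed.

(** * Pullback along continuous maps *)

(** Continuity within [D], unfolded so as to combine directly with [flat_on] and
    [section]. *)
Definition continuous_on (X Y : topologicalType) (D : set X) (h : X -> Y) :=
  forall x, D x -> forall U, nbhs (h x) U -> \forall y \near x, D y -> U (h y).

Lemma continuous_onP (X Y : topologicalType) (D : set X) (h : X -> Y) :
  {within D, continuous h} <-> continuous_on D h.
Proof. exact: subspace_continuousP. Qed.

Lemma flat_pullback (X Y : topologicalType) (D : set X) (E : set Y) (h : X -> Y)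
    (psi : Y -> Y -> bool) :
  continuous_on D h -> (forall x, D x -> E (h x)) -> flat_on E psi ->
  flat_on D (fun x y => psi (h x) (h y)).
Proof.
move=> ch hE fl x Dx; apply: filterS (ch x Dx _ (fl _ (hE _ Dx))) => y yP Dy.
by apply: filterS (ch y Dy _ (yP Dy (hE _ Dy))) => z zP Dz; apply: zP => //; exact: hE.
Qed.

Lemma section_pullback (X Y : topologicalType) (D : set X) (E : set Y)
    (h : X -> Y) (psi : Y -> Y -> bool) k :
  continuous_on D h -> (forall x, D x -> E (h x)) -> section psi E k ->
  section (fun x y => psi (h x) (h y)) D (k \o h).
Proof.
move=> ch hE kP x Dx; apply: filterS (ch x Dx _ (kP _ (hE _ Dx))) => y yP Dy.
by apply: yP => //; exact: hE.
Qed.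

Lemma eq_section (X : topologicalType) (D : set X) (psi psi' : X -> X -> bool) k :
  (forall x y, D x -> D y -> psi x y = psi' x y) ->
  section psi D k -> section psi' D k.
Proof.
by move=> e kP x Dx; apply: filterS (kP x Dx) => y yP Dy; rewrite yP // e.
Qed.

Lemma continuous_onU (X Y : topologicalType) (D E : set X) (h : X -> Y) :
  closed D -> closed E -> continuous_on D h -> continuous_on E h ->
  continuous_on (D `|` E) h.
Proof. by move=> cD cE hD hE x _ U hU; apply: near_closedU => // Dx; auto. Qed.

Lemma sub_continuous_on (X Y : topologicalType) (D E : set X) (h : X -> Y) :
  D `<=` E -> continuous_on E h -> continuous_on D h.
Proof.
move=> sub ch x /sub Ex U /(ch x Ex).
by apply: filterS => y yP /sub /yP.
Qed.

Lemma eq_continuous_on (X Y : topologicalType) (D : set X) (h h' : X -> Y) :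
  (forall x, D x -> h x = h' x) -> continuous_on D h -> continuous_on D h'.
Proof.
move=> e ch x Dx U; rewrite -e // => /(ch x Dx).
by apply: filterS => y yP Dy; rewrite -e //; exact: yP.
Qed.

Lemma continuous_on_comp (X Y Z : topologicalType) (D : set X) (E : set Y)
    (h : X -> Y) (f : Y -> Z) :
  continuous_on D h -> (forall x, D x -> E (h x)) -> continuous_on E f ->
  continuous_on D (f \o h).
Proof.
move=> ch hE cf x Dx U fU; apply: filterS (ch x Dx _ (cf _ (hE _ Dx) _ fU)).
by move=> y yP Dy; apply: yP => //; exact: hE.
Qed.

Lemma continuous_continuous_on (X Y : topologicalType) (D : set X) (h : X -> Y) :
  continuous h -> continuous_on D h.
Proof.
by move=> ch x _ U hU; have := ch x U hU; rewrite /= nbhs_simpl /=; apply: filterS.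
Qed.

(** * Double covers of a square *)

Section Square.
Variable R : realType.

(** Real induction: an interval property that holds on short intervals around
    each point and is stable under juxtaposition holds globally.  It replaces a
    Lebesgue number and a finite subdivision; the supremum of the reachable right
    ends is reached, and cannot be below [hi]. *)
Lemma cousin (P : R -> R -> Prop) (lo hi : R) :
  (forall x, lo <= x <= hi -> exists2 e, 0 < e & forall a b, lo <= a -> b <= hi ->
     x - e < a -> a <= x -> x <= b -> b < x + e -> P a b) ->
  (forall a b c, a <= b -> b <= c -> P a b -> P b c -> P a c) ->
  lo <= hi -> P lo hi.
Proof.
move=> loc glue lohi.
pose E := [set x | lo <= x <= hi /\ P lo x].
have Elo : E lo.
  split; first by rewrite lexx.
  have [|e e0] := loc lo; first by rewrite lexx.
  by apply=> //; lra.
have supE : has_sup E.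
  by split; [exists lo|exists hi => x [/andP[]]].
have lo_s : lo <= sup E by apply: ub_le_sup Elo; case: supE.
have s_hi : sup E <= hi by apply: ge_sup; [case: supE|move=> x [/andP[]]].
have [|e e0 eP] := loc (sup E); first by rewrite lo_s.
have [x [/andP[lox xhi] Px] xs] := sup_adherent e0 supE.
have xle : x <= sup E by apply: ub_le_sup; [case: supE|split=> //; rewrite lox].
have step y : sup E <= y -> y < sup E + e -> y <= hi -> P lo y.
  move=> sy ye yhi; apply: (glue _ x) => //; first exact: le_trans sy.
  exact: eP.
have [hie|ehi] := ltP hi (sup E + e); first exact: step.
have : E (sup E + e / 2).
  by split; [apply/andP; split|apply: step]; lra.
by move=> /(ub_le_sup supE.2); lra.
Qed.

Notation rect a b c d := (`[a, b] `*` `[c, d] : set (R * R)%type).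

Lemma closed_rect (a b c d : R) : closed (rect a b c d).
Proof.
rewrite (_ : _ `*` _ = fst @^-1` `[a, b] `&` snd @^-1` `[c, d]) //.
apply: closedI; apply: closed_comp; try exact: interval_closed.
  by move=> x _; exact: cvg_fst.
by move=> x _; exact: cvg_snd.
Qed.

Lemma connected_rect_vert (a c d : R) : connected (rect a a c d).
Proof.
rewrite (_ : rect a a c d = (fun t => (a, t)) @` `[c, d]).
  apply: connected_continuous_connected; first exact: segment_connected.
  apply: continuous_subspaceT => t.
  by have /= := cvg_pair (cvg_cst a) (@cvg_id _ (nbhs t)); exact.
apply/seteqP; split=> [[x y] [/=]|_ [t tcd] <-].
  rewrite in_itv /= => /andP[ax xa] ycd; exists y => //.
  by congr (_, _); apply/eqP; rewrite eq_le ax xa.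
by split=> //=; rewrite in_itv /= lexx.
Qed.

Lemma connected_rect_horiz (a b c : R) : connected (rect a b c c).
Proof.
rewrite (_ : rect a b c c = (fun t => (t, c)) @` `[a, b]).
  apply: connected_continuous_connected; first exact: segment_connected.
  apply: continuous_subspaceT => t.
  by have /= := cvg_pair (@cvg_id _ (nbhs t)) (cvg_cst c); exact.
apply/seteqP; split=> [[x y] [/=]|_ [t tab] <-].
  rewrite !in_itv /= => xab /andP[cy yc]; exists x => //=.
  by congr (_, _); apply/eqP; rewrite eq_le cy yc.
by split=> //=; rewrite in_itv /= lexx.
Qed.

(** [cousin] is used twice: first horizontally, at a fixed height [s], to get a
    section on a strip of positive thickness around [[0, 1] * {s}], then vertically
    to stack such strips.  Adjacent rectangles overlap in a segment, which is
    connected, as [section_glue] requires. *)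
Lemma square_section (psi : R * R -> R * R -> bool) :
  flat_on (rect 0 1 0 1) psi -> exists k, section psi (rect 0 1 0 1) k.
Proof.
move=> fl.
pose Q c d := exists k, section psi (rect 0 1 c d) k.
apply: (@cousin Q) => //; last first.
  move=> a b c ab bc [k kP] [l lP].
  have [m mP] : exists m, section psi (rect 0 1 a b `|` rect 0 1 b c) m.
    apply: (section_glue _ _ _ kP lP); [exact: closed_rect|exact: closed_rect|].
    rewrite (_ : _ `&` _ = rect 0 1 b b); first exact: connected_rect_horiz.
    apply/seteqP; split=> -[x y]; rewrite /= !in_itv /=; first by lra.
    by move=> [/andP[-> ->] /andP[bley yleb]]; split; split=> //; lra.
  exists m; apply: sub_section mP => -[x y]; rewrite /= !in_itv /= => -[xab yac].
  by have [yb|yb] := leP y b; [left|right]; split=> //; lra.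
move=> s s01.
(* P a b: sections exist over [a, b] times every short interval around s *)
pose P a b := exists2 e : R, 0 < e & forall c d : R, 0 <= c -> d <= 1 ->
  s - e < c -> c <= s -> s <= d -> d < s + e -> exists k, section psi (rect a b c d) k.
apply: (@cousin P) => //; last first.
  move=> a b c ab bc [e e0 eP] [f f0 fP].
  exists (Num.min e f); first by rewrite lt_min e0 f0.
  move=> u v u0 v1; rewrite ltrBlDr => usef us sv vsef.
  have me : Num.min e f <= e by rewrite ge_min lexx.
  have mf : Num.min e f <= f by rewrite ge_min lexx orbT.
  have [||k kP] := eP u v u0 v1 _ us sv; try lra.
  have [||l lP] := fP u v u0 v1 _ us sv; try lra.
  have [m mP] : exists m, section psi (rect a b u v `|` rect b c u v) m.
    apply: (section_glue _ _ _ kP lP); [exact: closed_rect|exact: closed_rect|].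
    rewrite (_ : _ `&` _ = rect b b u v); first exact: connected_rect_vert.
    apply/seteqP; split=> -[x y]; rewrite /= !in_itv /=; first by lra.
    by move=> [/andP[bley yleb] /andP[-> ->]]; split; split=> //; lra.
  exists m; apply: sub_section mP => -[x y]; rewrite /= !in_itv /= => -[xab yac].
  by have [yb|yb] := leP x b; [left|right]; split=> //; lra.
move=> t t01.
have Dts : rect 0 1 0 1 (t, s) by split; rewrite /= in_itv.
have /nbhs_ballP [e /= e0 eP] := fl _ Dts.
exists e => // a b a0 b1 ta at_ tb bt; exists e => // c d c0 d1 sc cs sd ds.
exists (psi (t, s)).
have sub : rect a b c d `<=` rect 0 1 0 1.
  by move=> [x y]; rewrite /= !in_itv /= => -[]; lra.
move=> [x y] xyD; have /eP /(_ (sub _ xyD)) : ball (t, s) e (x, y).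
  move: xyD; rewrite /= !in_itv /= => -[xab ycd].
  by split; rewrite /ball /= ltr_norml; lra.
by apply: filterS => z zP /sub /zP ->.
Qed.

End Square.

(** * Transport along paths and global sections *)

Section Transport.
Variables (R : realType) (M : topologicalType) (psi : M -> M -> bool).
Hypothesis psi_flat : flat_on setT psi.
Notation I := (`[0, 1]%classic : set R).
Notation rect := (`[0, 1] `*` `[0, 1] : set (R * R)%type).
Implicit Types (c d : R -> M) (k l : R -> bool) (p q r : M) (a b : bool).

(** Lifting a path from [p] to [q] to the double cover leads from the sheet [a]
    over [p] to the sheet [b] over [q]. *)
Definition transported p a q b := exists c k,
  [/\ continuous_on I c, section (fun s t => psi (c s) (c t)) I k,
      (c 0, k 0) = (p, a) & (c 1, k 1) = (q, b)].

Lemma continuous_affine (a b : R) : continuous (fun t : R => a * t + b).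
Proof.
move=> t; apply: cvgD; last exact: cvg_cst.
by apply: cvgM; [exact: cvg_cst|exact: cvg_id].
Qed.

Lemma affine_pullback (a b : R) (D : set R) c k c' k' :
  (forall t, D t -> I (a * t + b)) ->
  (forall t, D t -> c' t = c (a * t + b)) ->
  (forall t, D t -> k' t = k (a * t + b)) ->
  continuous_on I c -> section (fun s t => psi (c s) (c t)) I k ->
  continuous_on D c' /\ section (fun s t => psi (c' s) (c' t)) D k'.
Proof.
move=> DI c'E k'E cc kP.
have ca : continuous_on D (fun t => a * t + b).
  exact/continuous_continuous_on/continuous_affine.
split.
  have := continuous_on_comp ca DI cc; apply: eq_continuous_on => t Dt /=.
  by rewrite c'E.
have := section_pullback ca DI kP => kP' x Dx.
apply: filterS (kP' x Dx) => y yP Dy.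
by rewrite !c'E // !k'E //; exact: yP.
Qed.

Lemma transported_trans p a q b r e :
  transported p a q b -> transported q b r e -> transported p a r e.
Proof.
move=> [c [k [cc kP [c0 k0] [c1 k1]]]] [d [l [cd lP [d0 l0] [d1 l1]]]].
pose c' (t : R) := if t <= 1 / 2 then c (2 * t + 0) else d (2 * t + -1).
pose k' (t : R) := if t <= 1 / 2 then k (2 * t + 0) else l (2 * t + -1).
(* at t = 1 / 2 both branches give the common end of the two lifts *)
have half : 2 * (1 / 2) = 1 :> R by rewrite mul1r divff.
have [|||cA kA] := @affine_pullback 2 0 `[0, 1 / 2] c k c' k' _ _ _ cc kP.
- by move=> t /=; rewrite !in_itv /=; lra.
- by move=> t /=; rewrite in_itv /= /c' => /andP[_ ->].
- by move=> t /=; rewrite in_itv /= /k' => /andP[_ ->].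
have [|||cB kB] := @affine_pullback 2 (-1) `[1 / 2, 1] d l c' k' _ _ _ cd lP.
- by move=> t /=; rewrite !in_itv /=; lra.
- move=> t /=; rewrite in_itv /= /c' => /andP[t2 _]; case: ifP => // t2'.
  have -> : t = 1 / 2 by apply/eqP; rewrite eq_le t2 t2'.
  by rewrite half addr0 subrr c1 d0.
- move=> t /=; rewrite in_itv /= /k' => /andP[t2 _]; case: ifP => // t2'.
  have -> : t = 1 / 2 by apply/eqP; rewrite eq_le t2 t2'.
  by rewrite half addr0 subrr k1 l0.
have sub : I `<=` `[0, 1 / 2] `|` `[1 / 2, 1].
  move=> t /=; rewrite !in_itv /= => t01.
  by have [t2|t2] := leP t (1 / 2); [left|right]; lra.
have cl (x y : R) : closed `[x, y] by exact: interval_closed.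
have h01 : ((0 : R) <= 1 / 2) /\ ((1 : R) <= 1 / 2) = false.
  by split; [|apply/negbTE; rewrite -ltNge]; lra.
exists c', k'; split.
- by apply: sub_continuous_on sub _; exact: continuous_onU (cl _ _) (cl _ _) cA cB.
- by apply: sub_section sub _; exact: sectionU (cl _ _) (cl _ _) kA kB.
- by rewrite /c' /k' h01.1 mulr0 addr0 c0 k0.
- by rewrite /c' /k' h01.2 mulr1 (_ : 2 + -1 = 1) ?d1 ?l1 //; lra.
Qed.

Lemma transported_sym p a q b : transported p a q b -> transported q b p a.
Proof.
move=> [c [k [cc kP [c0 k0] [c1 k1]]]].
have [|||cA kA] := @affine_pullback (-1) 1 I c k
  (fun t => c (-1 * t + 1)) (fun t => k (-1 * t + 1)) _ _ _ cc kP => //.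
  by move=> t /=; rewrite !in_itv /=; lra.
exists (fun t => c (-1 * t + 1)), (fun t => k (-1 * t + 1)); split=> //.
  by rewrite mulr0 add0r c1 k1.
by rewrite mulr1 addNr c0 k0.
Qed.

(** A path is a square that is constant in the first coordinate. *)
Lemma path_section c : continuous_on I c ->
  exists k, section (fun s t => psi (c s) (c t)) I k.
Proof.
move=> cc.
have csnd : continuous_on rect (c \o snd).
  apply: (@continuous_on_comp _ _ _ _ I) => //; last by move=> x [].
  by apply: continuous_continuous_on => x; exact: cvg_snd.
have [K KP] := square_section (flat_pullback csnd (fun _ _ => Logic.I) psi_flat).
exists (K \o (fun t => (0, t))).
apply: (@section_pullback _ _ I rect (fun t => (0, t)) _ K _ _ KP).
  apply: continuous_continuous_on => t.
  by have /= := cvg_pair (cvg_cst (0 : R)) (@cvg_id _ (nbhs t)); exact.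
by move=> t It; split=> //=; rewrite in_itv /= lexx ler01.
Qed.

(** Lift a null-homotopy [H] of the loop.  The lift is constant on the three sides
    of the square that [H] contracts to the base point, hence takes equal values at
    both ends of the fourth side, which is the loop. *)
Lemma monodromy c k : simply_connected R M ->
  continuous_on I c -> section (fun s t => psi (c s) (c t)) I k ->
  c 0 = c 1 -> k 0 = k 1.
Proof.
move=> [_ sc] cc kP c01.
have [H [/continuous_onP cH Hc H1 Hs]] := sc c (iffRL (continuous_onP _ _) cc) c01.
have [K KP] := square_section (flat_pullback cH (fun _ _ => Logic.I) psi_flat).
have I0 : I 0 by rewrite /= in_itv /= lexx ler01.
have I1 : I 1 by rewrite /= in_itv /= lexx ler01.
have cI : connected I by exact: segment_connected.
have horiz (t : R) : continuous_on I (fun s : R => (s, t)).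
  apply: continuous_continuous_on => s.
  by have /= := cvg_pair (@cvg_id _ (nbhs s)) (cvg_cst t); exact.
have vert (s : R) : continuous_on I (fun t : R => (s, t)).
  apply: continuous_continuous_on => t.
  by have /= := cvg_pair (cvg_cst s) (@cvg_id _ (nbhs t)); exact.
(* the three sides on which H is constant carry the zero cocycle *)
have psi0 : psi (c 0) (c 0) = false by exact: flat_refl psi_flat _.
have bottom := section_pullback (horiz 0) (fun s Is => conj Is I0) KP.
have top := section_pullback (horiz 1) (fun s Is => conj Is I1) KP.
have right_side := section_pullback (vert 1) (fun s Is => conj I1 Is) KP.
have left_side := section_pullback (vert 0) (fun s Is => conj I0 Is) KP.
have K0 : K (0, 0) = K (1, 0).
  apply: (section_const cI _ bottom) => // s t Is It.
  by rewrite !(Hs _ _).1 ?psi0 ?inE.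
have K1 : K (0, 1) = K (1, 1).
  apply: (section_const cI _ top) => // s t Is It.
  by rewrite !(Hs _ _).2 ?psi0 ?inE.
have K2 : K (1, 0) = K (1, 1).
  apply: (section_const cI _ right_side) => // s t Is It.
  by rewrite !H1 ?psi0 ?inE.
have KP0 : section (fun s t => psi (c s) (c t)) I (fun t => K (0, t)).
  by apply: eq_section left_side => s t Is It; rewrite !Hc ?inE.
have := section_unique cI KP0 kP I0 I1.
by rewrite K0 K2 -K1; exact: addbI.
Qed.

Definition locally_path_connected := forall q (U : set M), nbhs q U ->
  \forall r \near q, exists c, [/\ continuous_on I c, c 0 = q, c 1 = r &
    forall t, I t -> U (c t)].

(** Transport the sheet [false] from a base point.  The result does not depend on
    the path by [monodromy]; it is continuous because a short path from [q] to a
    nearby point transports along [psi q]. *)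
Lemma flat_global_section : simply_connected R M -> locally_path_connected ->
  exists F, section psi setT F.
Proof.
move=> sc lpc.
have [[x0 _]|none] := pselect (exists x0 : M, True); last first.
  by exists (fun=> true) => x; exfalso; apply: none; exists x.
have uniq q b b' : transported x0 false q b -> transported x0 false q b' -> b = b'.
  move=> /transported_sym qb qb'.
  have [c [k [cc kP [c0 k0] [c1 k1]]]] := transported_trans qb qb'.
  by rewrite -k0 -k1; apply: monodromy sc cc kP _; rewrite c0.
have /choice [F FP] : forall q, exists b, transported x0 false q b.
  move=> q; have [c [/continuous_onP cc c0 c1]] := sc.1 x0 q.
  have [k kP] := path_section cc.
  (* normalise the section to start on the sheet false *)
  exists (k 1 (+) k 0), c, (fun t => k t (+) k 0); split => //.
  - exact: section_shift.
  - by rewrite c0 addbb.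
  - by rewrite c1.
exists F => q _; have := lpc q _ (psi_flat (Logic.I : setT q)).
apply: filterS => r [c [cc c0 c1 cU]] _.
apply: uniq (FP r) _; apply: transported_trans (FP q) _.
exists c, (fun t => F q (+) psi q (c t)); split=> //.
- move=> t It; apply: filterS (cc t It _ (cU t It Logic.I)) => s sP Is.
  by rewrite (sP Is Logic.I) addbA.
- by rewrite c0 (flat_refl psi_flat) // addbF.
- by rewrite c1.
Qed.

End Transport.

(** * The graph of a cover by connected open sets *)

Section Cover.
Variables (M : topologicalType) (G : graph M) (O : M -> set M).
Hypothesis O_open : forall x, vert G x -> open (O x).
Hypothesis O_connected : forall x, vert G x -> connected (O x).
Hypothesis O_self : forall x, vert G x -> O x x.
Hypothesis O_cover : \bigcup_(x in vert G) O x = [set: M].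
Hypothesis O_edge : forall x y, vert G x -> vert G y -> x <> y ->
  ((O x `&` O y !=set0) <-> edge G x y).

Lemma close_meet u v p : vert G u -> vert G v -> O u p -> O v p -> close G u v.
Proof.
move=> Vu Vv up vp; have [|uv] := pselect (u = v); first by left.
by right; apply/O_edge => //; exists p.
Qed.

Lemma cover_exists p : exists2 v, vert G v & O v p.
Proof. by have : [set: M] p by []; rewrite -O_cover => -[v]; exists v. Qed.

(** Label each point [p] by a vertex [vx p] whose open set contains it; then
    [phi (vx p) (vx q)] defines a double cover of [M], because vertices whose open
    sets share a point are pairwise equal or adjacent.  A global section [F],
    expressed in the chart of [u] as [k u], is locally constant on the connected
    set [O u]; its value there is the potential at [u]. *)
Lemma cover_cocycles_trivial (R : realType) : simply_connected R M ->
  locally_path_connected R M -> cocycles_trivial G.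
Proof.
move=> sc lpc phi phiC.
have /choice [vx vxP] : forall p, exists v, vert G v /\ O v p.
  by move=> p; have [v Vv vp] := cover_exists p; exists v.
have near_O v p : vert G v -> O v p -> nbhs p (O v).
  by move=> Vv vp; apply: open_nbhs_nbhs; split=> //; exact: O_open.
have phi_at p u v w : vert G u -> vert G v -> vert G w ->
    O u p -> O v p -> O w p -> phi u w = phi u v (+) phi v w.
  by move=> Vu Vv Vw up vp wp; apply: phiC; apply: (@close_meet _ _ p).
pose psi p q := phi (vx p) (vx q).
have psi_flat : flat_on setT psi.
  move=> p _; have [Vp Op] := vxP p; apply: filterS (near_O _ _ Vp Op) => q pq _.
  have [Vq Oq] := vxP q.
  apply: filterS2 (near_O _ _ Vp pq) (near_O _ _ Vq Oq) => r pr qr _.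
  by have [Vr Or] := vxP r; exact: (phi_at r).
have [F FP] := flat_global_section psi_flat sc lpc.
pose k u q := F q (+) phi (vx q) u.
have k_const u p q : vert G u -> O u p -> O u q -> k u p = k u q.
  move=> Vu; apply: locally_constant_connected; first exact: O_connected.
  move=> x ux; have [Vx Ox] := vxP x.
  apply: filterS2 (near_O _ _ Vx Ox) (FP x Logic.I) => y xy FPy uy.
  have [Vy Oy] := vxP y.
  rewrite /k FPy // (phi_at y (vx x) (vx y) u) //.
  by rewrite /psi addbA.
exists (fun u => k u u) => u v uv.
have [Vu Vv] := (edge_vert uv, edge_vertr uv).
have uNv : u <> v by move=> e; rewrite e in uv; exact: edge_irrefl uv.
have /(O_edge Vu Vv uNv) [q [uq vq]] := uv.
rewrite (k_const u u q) ?(k_const v v q) //; do ?exact: O_self.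
have [Vq Oq] := vxP q.
rewrite /k (phi_at q (vx q) u v) //.
by case: (F q); case: (phi (vx q) u); case: (phi u v).
Qed.

(** Otherwise the open sets of the vertices joined to [u] and those of the
    remaining vertices would disconnect [C]: they cannot overlap, since an overlap
    is an edge. *)
Lemma connected_cover_joined (C : set M) u w : connected C ->
  vert G u -> vert G w -> O u `&` C !=set0 -> O w `&` C !=set0 ->
  joined_in G [set v | vert G v /\ O v `&` C !=set0] u w.
Proof.
set W := [set v | _] => cC Vu Vw uC wC.
have uu : joined_in G W u u by apply: joined_in_refl.
have stepW v v' p : joined_in G W u v -> vert G v' -> C p -> O v p -> O v' p ->
    joined_in G W u v'.
  move=> uv Vv' Cp vp v'p; have [Vv _] := joined_in_vertr uv.
  have [<- //|vv'] := close_meet Vv Vv' vp v'p.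
  by apply: joined_in_step uv _ vv'; split=> //; exists p.
pose J := [set v | joined_in G W u v].
have eC : C `&` \bigcup_(v in J) O v = C.
  have openU (E : set M) : E `<=` vert G -> open (\bigcup_(v in E) O v).
    by move=> EV; apply: bigcup_open => v /EV; exact: O_open.
  apply: cC.
  - by have [p [up Cp]] := uC; exists p; split=> //; exists u.
  - exists (\bigcup_(v in J) O v) => //; apply: openU => v uv.
    by have [] := joined_in_vertr uv.
  - exists (~` \bigcup_(v in vert G `\` J) O v).
      by apply: open_closedC; apply: openU => v [].
    apply/seteqP; split=> p [Cp].
      move=> [v uv vp]; split=> // -[v' [Vv' nuv'] v'p].
      by apply: nuv'; exact: stepW uv Vv' Cp vp v'p.
    move=> np; split=> //; have [v Vv vp] := cover_exists p.
    by exists v => //; apply: contrapT => nJ; apply: np; exists v.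
have [p [wp Cp]] := wC.
have [_ [v uv vp]] : (C `&` \bigcup_(v in J) O v) p by rewrite eC.
exact: stepW uv Vw Cp vp wp.
Qed.

(** Consecutive sets along the ray are connected and overlap. *)
Lemma ray_union_in_component (B : set M) (r : nat -> M) N :
  (forall i, edge G (r i) (r i.+1)) ->
  (forall i, (N <= i)%N -> O (r i) `<=` ~` B) ->
  forall i, (N <= i)%N -> O (r i) `<=` connected_component (~` B) (r N).
Proof.
move=> rE rB.
have V i : vert G (r i) by exact: edge_vert (rE i).
have grow x y z : O (r x) `<=` ~` B -> O (r x) y -> O (r x) z ->
    connected_component (~` B) y z.
  by move=> xB xy xz; apply: connected_component_max xz => //; exact: O_connected.
elim=> [|i IH].
  rewrite leqn0 => /eqP N0 z rz; rewrite N0.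
  by apply: (grow 0%N) => //; [apply: rB; rewrite N0|exact: O_self].
rewrite leq_eqVlt => /orP[/eqP Ni z rz|Ni].
  by rewrite Ni in rB *; apply: (grow i.+1) => //; [exact: rB|exact: O_self].
have ne : r i <> r i.+1.
  by move=> e; have := rE i; rewrite -e; exact: edge_irrefl.
have [y [iy i1y]] : O (r i) `&` O (r i.+1) !=set0 by apply/O_edge.
move=> z i1z; apply: (@connected_component_trans _ _ y); first exact: (IH Ni).
by apply: (grow i.+1) => //; apply: rB; exact: ltnW.
Qed.

End Cover.

(** * Riemannian manifolds *)

Section Manifold.
Variables (R : realType) (n : nat) (M : topologicalType).
Variable g : riemannian_manifold R n M.

(** Nearby points are joined by a segment in a chart. *)
Lemma manifold_locally_path_connected : locally_path_connected R M.
Proof.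
move=> q U qU; pose i := chart_at g q; pose z := chart g i q.
have qi : dom g i q by exact: dom_chart_at.
have zi : img g i z by exact: chart_img.
have paramz : param g i z = q by exact: chartK.
have : nbhs z (img g i `&` param g i @^-1` U).
  apply: filterI; first by apply: open_nbhs_nbhs; split=> //; exact: img_open.
  by apply: (param_continuous zi); rewrite paramz.
move=> /nbhs_ballP [e /= e0 eP].
have near_dom : nbhs q (dom g i).
  by apply: open_nbhs_nbhs; split=> //; exact: dom_open.
have near_ball : nbhs q (chart g i @^-1` ball z e).
  by apply: (chart_continuous qi); exact: nbhsx_ballx.
apply: filterS2 near_dom near_ball => r ri rz.
pose line (t : R) := z + t *: (chart g i r - z).
have line_ball t : `[0, 1]%classic t -> ball z e (line t).
  rewrite /= in_itv /= => /andP[t0 t1]; move: rz.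
  rewrite /line /= -ball_normE /ball_ /= opprD addNKr normrN normrZ distrC.
  by apply: le_lt_trans; rewrite ger0_norm // ler_piMl.
exists (param g i \o line); split.
- move=> t It W tW; have [img_t _] := eP _ (line_ball t It).
  have line_cont : {for t, continuous line}.
    apply: cvgD; first exact: cvg_cst.
    by apply: cvgZ; [exact: cvg_id|exact: cvg_cst].
  have : nbhs t (line @^-1` (param g i @^-1` W)).
    exact: line_cont _ (param_continuous img_t tW).
  by apply: filterS.
- by rewrite /= /line scale0r addr0.
- by rewrite /= /line scale1r addrC subrK chartK.
- by move=> t /line_ball /eP [].
Qed.

End Manifold.

Section Bounded.
Variables (R : realType) (n : nat) (M : topologicalType).
Variable g : riemannian_manifold R n M.
Implicit Types (p q r : M) (B : set M).

Lemma curve_joins_trans p q r l m :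
  curve_joins g p q l -> curve_joins g q r m -> curve_joins g p r (l + m)%E.
Proof.
elim=> [s|c s k cc _ IH] sr; first by rewrite add0e.
by rewrite -addeA; apply: curve_cons cc (IH sr).
Qed.

Lemma riem_dist_trans p q r (a b : R) :
  (riem_dist g p q <= a%:E)%E -> (riem_dist g q r <= b%:E)%E ->
  (riem_dist g p r <= (a + b)%:E)%E.
Proof.
move=> pq qr; apply/lee_addgt0Pr => e e0.
have half s (x : R) : (s <= x%:E -> s < (x + e / 2)%:E)%E.
  by move=> sx; apply: le_lt_trans sx _; rewrite lte_fin ltrDl divr_gt0.
have [l pql la] := ereal_inf_lt (half _ _ pq).
have [m qrm mb] := ereal_inf_lt (half _ _ qr).
apply: le_trans (ereal_inf_lbound (curve_joins_trans pql qrm)) _.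
apply: le_trans (leeD (ltW la) (ltW mb)) _.
by rewrite -!EFinD lee_fin; lra.
Qed.

Lemma sub_riem_bounded B B' : B `<=` B' -> riem_bounded g B' -> riem_bounded g B.
Proof. by move=> sub [r rP]; exists r => p q /sub Bp /sub Bq; exact: rP. Qed.

(** Finiteness of distances is a genuine condition here: [riem_dist] takes values
    in the extended reals. *)
Lemma riem_boundedU B B' :
  (forall p q, exists r : R, (riem_dist g p q <= r%:E)%E) ->
  riem_bounded g B -> riem_bounded g B' -> riem_bounded g (B `|` B').
Proof.
move=> fin [r rP] [r' r'P].
have [[p0 Bp0]|B0] := pselect (B !=set0); last first.
  exists r' => p q [Bp|Bp]; first by exfalso; apply: B0; exists p.
  by move=> [Bq|Bq]; [exfalso; apply: B0; exists q|exact: r'P].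
have [[q0 Bq0]|B'0] := pselect (B' !=set0); last first.
  exists r => p q [Bp|Bp]; last by exfalso; apply: B'0; exists p.
  by move=> [Bq|Bq]; [exact: rP|exfalso; apply: B'0; exists q].
have [s sP] := fin p0 q0; have [s' s'P] := fin q0 p0.
have abs (x : R) : x <= `|x| /\ 0 <= `|x| by rewrite ler_norm normr_ge0.
have [[? ?] [? ?]] := (abs r, abs r').
have [[? ?] [? ?]] := (abs s, abs s').
exists (`|r| + `|r'| + `|s| + `|s'|) => p q.
have weaken (x : R) : x <= `|r| + `|r'| + `|s| + `|s'| ->
    (riem_dist g p q <= x%:E)%E ->
    (riem_dist g p q <= (`|r| + `|r'| + `|s| + `|s'|)%:E)%E.
  by move=> xle pq; apply: le_trans pq _; rewrite lee_fin.
move=> [Bp|Bp] [Bq|Bq].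
- by apply: weaken (rP _ _ Bp Bq); lra.
- apply: weaken (riem_dist_trans (rP _ _ Bp Bp0) (riem_dist_trans sP (r'P _ _ Bq0 Bq))).
  by lra.
- apply: weaken (riem_dist_trans (r'P _ _ Bp Bq0) (riem_dist_trans s'P (rP _ _ Bp0 Bq))).
  by lra.
- by apply: weaken (r'P _ _ Bp Bq); lra.
Qed.

Lemma riem_bounded_bigcup (F : set M) (O : M -> set M) :
  (forall p q, exists r : R, (riem_dist g p q <= r%:E)%E) ->
  finite_set F -> (forall x, F x -> riem_bounded g (O x)) ->
  riem_bounded g (\bigcup_(x in F) O x).
Proof.
move=> fin /finite_seqP [s ->] bO; rewrite bigcup_seq big_seq.
apply: big_ind => //; first by exists 0.
by move=> B B'; exact: riem_boundedU.
Qed.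

End Bounded.

(** * Ends of the graph and of the manifold *)

Section Ends.
Variables (R : realType) (n : nat) (M : topologicalType).
Variables (g : riemannian_manifold R n M) (G : graph M) (O : M -> set M).
Hypothesis M_connected : connected [set: M].
Hypothesis O_open : forall x, vert G x -> open (O x).
Hypothesis O_connected : forall x, vert G x -> connected (O x).
Hypothesis O_self : forall x, vert G x -> O x x.
Hypothesis O_cover : \bigcup_(x in vert G) O x = [set: M].
Hypothesis O_edge : forall x y, vert G x -> vert G y -> x <> y ->
  ((O x `&` O y !=set0) <-> edge G x y).
Hypothesis O_bounded : forall x, vert G x -> riem_bounded g (O x).
Hypothesis O_finite : forall B : set M, riem_bounded g B ->
  finite_set [set x | vert G x /\ B `&` O x !=set0].

(** Points are linked through a chain of overlapping sets [O v], each of which is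
    bounded; this avoids estimating lengths of curves. *)
Lemma riem_dist_finite p q : exists r : R, (riem_dist g p q <= r%:E)%E.
Proof.
have [u Vu up] := cover_exists O_cover p.
have [w Vw wq] := cover_exists O_cover q.
have uw : joined_in G [set v | vert G v /\ O v `&` setT !=set0] u w.
  by apply: (connected_cover_joined O_open O_cover O_edge) => //; [exists p|exists q].
suff H : forall q', O w q' -> exists r : R, (riem_dist g p q' <= r%:E)%E by exact: H.
move: {Vw wq} w uw; apply: joined_in_ind => [_ _ q' uq'|v v' IH [Vv _] [Vv' _] vv' q' v'q'].
  by have [r rP] := O_bounded Vu; exists r; exact: rP.
have ne : v <> v' by move=> e; move: vv'; rewrite e; exact: edge_irrefl.
have [s [vs v's]] : O v `&` O v' !=set0 by apply/O_edge.
have [r rP] := IH _ vs; have [r' r'P] := O_bounded Vv'.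
by exists (r + r'); apply: riem_dist_trans rP (r'P _ _ v's v'q').
Qed.

Lemma cover_locally_finite : locally_finite G.
Proof.
move=> x Vx; apply: sub_finite_set (O_finite (O_bounded Vx)) => y xy.
have Vy := edge_vertr xy; split=> //; apply/O_edge => // e.
by move: xy; rewrite /= e; exact: edge_irrefl.
Qed.

(** The infinite component is that of the vertices whose open sets meet the
    unbounded component [C] of the complement of [B].  For uniqueness, a component
    is replaced by a ray in it: an arbitrary infinite component has sets [O v] that
    may overlap [B] and be cut by it, while the tail of the ray is free of [B]. *)
Lemma cover_one_ended : one_ended_manifold g -> one_ended_graph G.
Proof.
move=> oe Gamma finG GV.
pose B := \bigcup_(v in Gamma) O v.
have bounded_union F : finite_set F -> F `<=` vert G ->
    riem_bounded g (\bigcup_(v in F) O v).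
  move=> finF FV; apply: riem_bounded_bigcup => // [|v /FV]; last exact: O_bounded.
  exact: riem_dist_finite.
have bB : riem_bounded g B by exact: bounded_union.
have [C [[[p Bp CE] ubC] Cuniq]] := oe B bB.
have cC : connected C by rewrite CE; exact: component_connected.
have CB : C `<=` ~` B by rewrite CE; exact: connected_component_sub.
have Cp : C p by rewrite CE; exact: connected_component_refl.
set S := vert G `\` Gamma.
have meets_S v : vert G v -> O v `&` C !=set0 -> S v.
  by move=> Vv [q [vq Cq]]; split=> // Gv; apply: (CB q Cq); exists v.
have joined_C u v : vert G u -> vert G v -> O u `&` C !=set0 ->
    O v `&` C !=set0 -> joined_in G S u v.
  move=> Vu Vv uC vC.
  apply: sub_joined_in (connected_cover_joined O_open O_cover O_edge cC Vu Vv uC vC).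
  by move=> w [Vw wC]; exact: meets_S.
have [v0 Vv0 v0p] := cover_exists O_cover p.
have v0C : O v0 `&` C !=set0 by exists p.
exists [set y | joined_in G S v0 y]; split.
  split; first by exists v0 => //; exact: meets_S.
  move=> fin; apply: ubC; apply: sub_riem_bounded (bounded_union _ fin _).
    move=> q Cq; have [v Vv vq] := cover_exists O_cover q.
    by exists v => //; apply: joined_C => //; exists q.
  by move=> y v0y; have [] := joined_in_vertr v0y.
move=> _ [[x Sx ->] inf].
have lf := cover_locally_finite.
have [r ray rS] := konig lf inf; have [_ rinj rE] := ray.
have [N rN] : exists N, forall i, (N <= i)%N ->
    ~ (\bigcup_(w in Gamma) [set v | edge G w v]) (r i).
  by apply: avoid_finite => //; apply: bigcup_finite => // w /GV; exact: lf.
have rB i : (N <= i)%N -> O (r i) `<=` ~` B.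
  move=> Ni q iq [w Gw wq]; have [Vi nGi] := rS i.
  have [e|wi] := close_meet O_edge (GV _ Gw) Vi wq iq.
    by apply: nGi; rewrite -e.
  by apply: (rN i Ni); exists w.
have rK := ray_union_in_component O_connected O_self O_edge rE rB.
have VN i : vert G (r i) := ray_vert i ray.
have KC : connected_component (~` B) (r N) = C.
  apply/esym/Cuniq; split.
    by exists (r N) => //; apply: (rB N) => //; exact: O_self.
  move=> bK; apply: (@tail_infinite _ r N _ rinj _ (O_finite bK)) => i Ni.
  by split=> //; exists (r i); split; [apply: (rK i Ni)|]; exact: O_self.
have v0N : joined_in G S v0 (r N).
  apply: joined_C => //; exists (r N); split; first exact: O_self.
  by rewrite -KC; apply: (rK N) => //; exact: O_self.
have xN : joined_in G S x (r N).
  have [r0 _ _] := ray; rewrite -{1}r0.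
  by apply: (ray_joined_in ray) => // k _; exact: rS.
by rewrite (component_eq v0N) (component_eq xN).
Qed.

End Ends.

(** * The theorem *)

Theorem theorem1p2 (R : realType) (n : nat) (M : topologicalType)
    (g : riemannian_manifold R n M)
    (M_connected : connected [set: M])
    (M_complete : riem_complete g)
    (M_noncompact : ~ compact [set: M])
    (M_simply_connected : simply_connected R M)
    (G : graph M) (O : M -> set M)
    (O_open : forall x, vert G x -> open (O x))
    (O_connected : forall x, vert G x -> connected (O x))
    (O_self : forall x, vert G x -> O x x)
    (O_cover : \bigcup_(x in vert G) O x = [set: M])
    (O_edge : forall x y, vert G x -> vert G y -> x <> y ->
       ((O x `&` O y !=set0) <-> edge G x y)) :
  (forall x y, vert G x -> vert G y ->
     forall Gamma : set M, minimal_cutset G x (Some y) Gamma ->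
       graph_connected G Gamma) /\
  (one_ended_graph G -> locally_finite G ->
     forall x, vert G x ->
     forall Gamma : set M, minimal_cutset G x None Gamma ->
       graph_connected G Gamma) /\
  (one_ended_manifold g ->
     (forall x, vert G x -> riem_bounded g (O x)) ->
     (forall B : set M, riem_bounded g B ->
        finite_set [set x | vert G x /\ B `&` O x !=set0]) ->
     one_ended_graph G /\ locally_finite G).
Proof.
have triv : cocycles_trivial G.
  apply: (cover_cocycles_trivial O_open O_connected O_self O_cover O_edge
    M_simply_connected).
  exact: manifold_locally_path_connected g.
split=> [x y _ _ Gamma|]; first exact: minimal_cutset_connected.
split=> [oe lf x _ Gamma|oe O_bounded O_finite].
  exact: minimal_cutset_infinity_connected.
split; first exact: cover_one_ended O_bounded O_finite oe.
exact: cover_locally_finite O_bounded O_finite.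
Qed.
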